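(* Let $Q$ be any integrally indecomposable polytope in $\mathbb{R}^m$ and $\pi:\mathbb{R}^n\to\mathbb{R}^m$ any integral linear map. Let $S$ be any set of integral points in $\pi^{-1}(Q)$ having exactly one point in $\pi^{-1}(v)$ for each vertex $v$ of $Q$. Then the polytope $\mathrm{conv}(S)$ in $\mathbb{R}^n$ is integrally indecomposable.
   Context: An integral polytope is a convex polytope whose vertices have integer coordinates. An integral polytope is integrally decomposable if it is the Minkowski sum $A+B=\{a+b:a\in A,b\in B\}$ of two integral polytopes $A,B$ each with more than one point, and integrally indecomposable otherwise (an integrally indecomposable polytope is in particular an integral polytope). A linear map $\pi:\mathbb{R}^n\to\mathbb{R}^m$ is integral if it maps points of $\mathbb{Z}^n$ to points of $\mathbb{Z}^m$. $\mathrm{conv}(S)$ denotes the convex hull of $S$.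
   Formalization: The set S is taken to be finite: for an infinite set S of integral points conv(S) is unbounded, hence not a polytope, so the claim as worded (''any set'') fails for infinite S; every finite S is covered. *)

(* Defs.v *)
From mathcomp Require Import all_boot all_order all_algebra.
From mathcomp Require Import boolp classical_sets cardinality reals convex.

Set Implicit Arguments.
Unset Strict Implicit.
Unset Printing Implicit Defensive.

Import Order.TTheory GRing.Theory Num.Theory.
Local Open Scope classical_set_scope.
Local Open Scope ring_scope.

Section Polytopes.
Context {R : realType} {d : nat}.
Implicit Types (x : 'rV[R]_d) (A B P S : set 'rV[R]_d).

Definition integral_point x : Prop := forall j, x 0 j \is a Num.int.

Definition conv_hull S : set 'rV[R]_d := smallest (@convex_set R 'rV[R]_d) S.

(* The empty set counts as a polytope. *)
Definition polytope P : Prop :=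
  exists2 F : set 'rV[R]_d, finite_set F & P = conv_hull F.

(* A vertex is a point of P interior to no nondegenerate segment contained
   in P. *)
Definition vertex P x : Prop :=
  P x /\ forall a b (t : R), P a -> P b -> 0 < t < 1 ->
    x = (1 - t) *: a + t *: b -> a = b.

Definition integral_polytope P : Prop :=
  polytope P /\ forall v, vertex P v -> integral_point v.

Definition minkowski_sum A B : set 'rV[R]_d :=
  [set a + b | a in A & b in B].

Definition has_two_points A : Prop :=
  exists x y, [/\ A x, A y & x <> y].

Definition integrally_decomposable P : Prop :=
  exists A B, [/\ integral_polytope A, integral_polytope B,
    has_two_points A, has_two_points B & P = minkowski_sum A B].

Definition integrally_indecomposable P : Prop :=
  integral_polytope P /\ ~ integrally_decomposable P.

End Polytopes.

Definition integral_map (R : realType) (n m : nat)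
    (f : 'rV[R]_n -> 'rV[R]_m) : Prop :=
  forall x, integral_point x -> integral_point (f x).

(* Main.v *)
Require Import Defs.
From mathcomp Require Import all_boot all_order all_algebra.
From mathcomp Require Import boolp classical_sets cardinality reals convex.
From mathcomp Require Import interval_inference.
From mathcomp Require Import ring lra.

(** The map pi sends P = conv S onto Q and, v being a vertex of Q, the fiber of
    P over v is the single point of S over v.  If P = A + B, then
    Q = pi(A) + pi(B), and pi(A), pi(B) are integral polytopes because their
    vertices lift to vertices of A and B.  If pi(B) were a point while B is not,
    choose a in A with pi(a) + pi(B) = v: the translate a + B would lie in the
    one-point fiber over v.  Hence pi(A) and pi(B) both have two points, against
    the indecomposability of Q. *)

Import Order.TTheory GRing.Theory Num.Theory.
Local Open Scope classical_set_scope.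
Local Open Scope ring_scope.

(** Restates convexity with a real parameter in the open interval and weight [t] on the second
    point, the form used in [vertex]. *)
Lemma convex_setP (R : realType) (d : nat) (A : set 'rV[R]_d) :
  @convex_set R 'rV[R]_d A <->
  forall x y (t : R), A x -> A y -> 0 < t < 1 -> A ((1 - t) *: x + t *: y).
Proof.
split=> [cA x y t Ax Ay /andP[t0 t1]|cA].
  have s0 : 0 <= 1 - t by lra.
  have s1 : 1 - t <= 1 by lra.
  have : A ((1 - t) *: x + (1 - (1 - t)) *: y).
    exact: set_mem (cA x y (Itv01 s0 s1) (mem_set Ax) (mem_set Ay)).
  by rewrite subKr.
apply/convex_setW => x y /set_mem Ax /set_mem Ay k k0 k1; apply/mem_set.
have /(cA _ _ _ Ax Ay) : 0 < 1 - k%:num < 1 by apply/andP; split; lra.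
by rewrite subKr.
Qed.

Section ConvHull.
Context {R : realType} {d : nat}.
Implicit Types (x f g v : 'rV[R]_d) (A C F P S : set 'rV[R]_d).

Lemma sub_conv_hull S : S `<=` conv_hull S.
Proof. exact: sub_gen_smallest. Qed.

Lemma conv_hull_sub S C :
  @convex_set R 'rV[R]_d C -> S `<=` C -> conv_hull S `<=` C.
Proof. exact: smallest_sub. Qed.

Lemma convex_conv_hull S : @convex_set R 'rV[R]_d (conv_hull S).
Proof.
apply/convex_setP => x y t Sx Sy t01 C [cC SC].
by have /convex_setP := cC; apply=> //; [apply: Sx|apply: Sy].
Qed.

Lemma conv_hull_segment x y t S : conv_hull S x -> conv_hull S y -> 0 < t < 1 ->
  conv_hull S ((1 - t) *: x + t *: y).
Proof. by have /convex_setP := convex_conv_hull S; apply. Qed.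

Lemma conv_hull_nonempty S : conv_hull S !=set0 -> S !=set0.
Proof.
move=> [x Sx]; apply/set0P/negP => /eqP S0.
suff : conv_hull S `<=` set0 by move=> /(_ x Sx).
by apply: conv_hull_sub; [apply/convex_setP|rewrite S0].
Qed.

(** Removing an extreme point from a convex set leaves a convex set. If [v] were not in [F], the
    hull without [v] would still contain [F], hence the whole hull. *)
Lemma vertex_conv_hull F v : vertex (conv_hull F) v -> F v.
Proof.
move=> [Fv ext]; apply: contrapT => nFv.
suff : conv_hull F `<=` conv_hull F `\ v by move=> /(_ v Fv) [_]; apply.
apply: conv_hull_sub => [|x Fx].
  apply/convex_setP => x y t [Fx xv] [Fy yv] t01; split.
    exact: conv_hull_segment.
  move=> /= xyv; apply: xv => /=; rewrite -xyv.
  rewrite -(ext x y t Fx Fy t01 (esym xyv)).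
  by rewrite -scalerDl subrK scale1r.
by split; [exact: sub_conv_hull|move=> /= xv; apply: nFv; rewrite -xv].
Qed.

(** The points described on the right form a convex set [J] containing [f] and [S]. Keeping [x = f]
    as a separate case allows [S] to be empty. *)
Lemma conv_hullU1 f S x : conv_hull (f |` S) x ->
  x = f \/ exists t g,
    [/\ 0 < t <= 1, conv_hull S g & x = (1 - t) *: f + t *: g].
Proof.
pose J := [set x | x = f \/
  exists t g, [/\ 0 < t <= 1, conv_hull S g & x = (1 - t) *: f + t *: g]].
move: x; apply: (@conv_hull_sub _ J) => [|x [->|Sx]]; last 2 first.
- by left.
- right; exists 1, x; rewrite lexx ltr01 subrr scale0r scale1r add0r.
  by split=> //; exact: sub_conv_hull.
apply/convex_setP => x y t Jx Jy /andP[t0 t1].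
case: Jx => [->|[a [g [/andP[a0 a1] Sg ->]]]];
  case: Jy => [->|[b [h [/andP[b0 b1] Sh ->]]]].
- by left; rewrite -scalerDl subrK scale1r.
- right; exists (t * b), h; split=> //; first by apply/andP; split; nra.
  by apply/rowP => j; rewrite !mxE; ring.
- right; exists ((1 - t) * a), g; split=> //; first by apply/andP; split; nra.
  by apply/rowP => j; rewrite !mxE; ring.
have ta0 : 0 < (1 - t) * a by nra.
have tb0 : 0 < t * b by nra.
(* [r] is the total weight carried by [g] and [h]; dividing by it merges them into one point of the
   hull of [S]. *)
pose r := (1 - t) * a + t * b.
have r0 : 0 < r by rewrite /r; lra.
right; exists r, ((1 - t * b / r) *: g + (t * b / r) *: h); split.
- by apply/andP; split=> //; rewrite /r; nra.
- apply: conv_hull_segment => //.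
  by rewrite divr_gt0//= ltr_pdivrMr// mul1r /r; lra.
- have rE : (1 - t) * a = r - t * b by rewrite /r addrK.
  by apply/rowP => j; rewrite !mxE /r; field; rewrite -/r gt_eqF.
Qed.

Lemma conv_hull_eq F C : F `<=` C -> C `<=` conv_hull F ->
  conv_hull F = conv_hull C.
Proof.
move=> FC CF; apply/seteqP; split; apply: conv_hull_sub => //.
- exact: convex_conv_hull.
- by move=> x /FC/sub_conv_hull.
- exact: convex_conv_hull.
Qed.

(** Generators lying in the hull of the others are discarded one at a time; the induction is on the
    length of a list of generators. *)
Lemma polytope_min P : polytope P ->
  exists F, [/\ finite_set F, P = conv_hull F &
    forall f, F f -> ~ conv_hull (F `\ f) f].
Proof.
move=> [F /finite_seqP[s ->]] -> {F}.
have [n] := ubnP (size s); elim: n s => // n IH s sn.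
have [[f [sf Hf]]|nf] :=
    pselect (exists f, f \in s /\ conv_hull ([set` s] `\ f) f); last first.
  exists [set` s]; split=> // f sf Hf; apply: nf; by exists f.
have E : [set` s] `\ f = [set` [seq x <- s | x != f]].
  apply/seteqP; split=> x /=; rewrite mem_filter.
    by move=> [-> /eqP ->].
  by move=> /andP[/eqP].
have [|F [finF FE Fm]] := IH [seq x <- s | x != f].
  apply: leq_trans (_ : (size s <= n)%N); last by rewrite -ltnS.
  rewrite size_filter -(count_predC (pred1 f) s) -[X in (X < _)%N]add0n.
  by rewrite ltn_add2r -has_count has_pred1.
exists F; split=> //; rewrite -FE -E; apply/esym/conv_hull_eq => [x []//|].
move=> x sx; have [->//|/eqP xf] := eqVneq x f.
by apply: sub_conv_hull; split.
Qed.

(** Suppose [f] is inside a segment of the hull. If one end is [f], so is the other. Otherwise both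
    ends involve points [g], [h] of the hull of the remaining generators, and solving for [f] puts
    it between [g] and [h]. *)
Lemma vertex_of_minimal F f :
  F f -> ~ conv_hull (F `\ f) f -> vertex (conv_hull F) f.
Proof.
move=> Ff nf; split; first exact: sub_conv_hull.
have FE : F = f |` (F `\ f) by rewrite setD1K.
move=> a b t; rewrite FE => /conv_hullU1 Fa /conv_hullU1 Fb /andP[t0 t1] fE.
case: Fa => [aE|[al [g [/andP[a0 a1] Sg aE]]]].
  apply/rowP => j; move/rowP: fE => /(_ j); rewrite aE !mxE => fE.
  by apply: (mulfI (lt0r_neq0 t0)); lra.
case: Fb => [bE|[be [h [/andP[b0 b1] Sh bE]]]].
  have t1' : 0 < 1 - t by lra.
  apply/rowP => j; move/rowP: fE => /(_ j); rewrite bE !mxE => fE.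
  by apply: (mulfI (lt0r_neq0 t1')); lra.
exfalso; apply: nf.
have ta0 : 0 < (1 - t) * al by nra.
have tb0 : 0 < t * be by nra.
(* The coefficient of [f] on the right of [fE] is [1 - r], so [r *: f] equals
   [((1 - t) * al) *: g + (t * be) *: h]. *)
pose r := (1 - t) * al + t * be.
have r0 : 0 < r by rewrite /r; lra.
suff E : f = (1 - t * be / r) *: g + (t * be / r) *: h.
  rewrite {2}E; apply: conv_hull_segment => //.
  by rewrite divr_gt0//= ltr_pdivrMr// mul1r /r; lra.
apply/rowP => j; move/rowP: fE => /(_ j); rewrite aE bE !mxE => fE.
apply: (mulfI (lt0r_neq0 r0)).
transitivity ((r - t * be) * g 0 j + t * be * h 0 j); last first.
  by field; rewrite gt_eqF.
by rewrite /r; lra.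
Qed.

(** An irredundant finite generating set is exactly the set of vertices. *)
Lemma polytope_vertices P : polytope P ->
  finite_set (vertex P) /\ P = conv_hull (vertex P).
Proof.
move=> /polytope_min[F [finF PE Fm]].
have -> // : vertex P = F.
apply/seteqP; split=> f; rewrite PE; first exact: vertex_conv_hull.
by move=> Ff; apply: vertex_of_minimal => //; exact: Fm.
Qed.

(* Since [v] is a vertex, the points of [pi @^-1` Q] that are not over [v],
   together with [s], form a convex set; it contains [S]. *)
Lemma conv_hull_fiber (m : nat) (pi : {linear 'rV[R]_d -> 'rV[R]_m})
    (Q : set 'rV[R]_m) S (v : 'rV[R]_m) s :
  @convex_set R 'rV[R]_m Q -> vertex Q v -> S `<=` pi @^-1` Q ->
  (forall x, S x -> pi x = v -> x = s) ->
  forall x, conv_hull S x -> pi x = v -> x = s.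
Proof.
move=> /convex_setP cQ [_ ext] SQ Ss x Sx.
suff : conv_hull S `<=` [set x | Q (pi x) /\ (pi x = v -> x = s)].
  by move=> /(_ x Sx)[].
apply: conv_hull_sub => [|y Sy]; last by split; [exact: SQ|exact: Ss].
apply/convex_setP => y z t [Qy ys] [Qz zs] t01.
rewrite /= linearD !linearZ /=; split; first exact: cQ.
(* Extremality of [v] forces both ends of the segment over [v], so both equal [s]. *)
move=> vE; have yz := ext _ _ _ Qy Qz t01 (esym vE).
have yv : pi y = v by rewrite -vE -yz -scalerDl subrK scale1r.
by rewrite (ys yv) (zs (etrans (esym yz) yv)) -scalerDl subrK scale1r.
Qed.

End ConvHull.

Lemma image_conv_hull (R : realType) (n m : nat)
    (pi : {linear 'rV[R]_n -> 'rV[R]_m}) (S : set 'rV[R]_n) :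
  pi @` conv_hull S = conv_hull (pi @` S).
Proof.
apply/seteqP; split.
  apply/image_subP; apply: conv_hull_sub => [|x Sx].
    apply/convex_setP => x y t Sx Sy t01.
    by rewrite /= linearD !linearZ; exact: conv_hull_segment.
  by apply: sub_conv_hull; exists x.
apply: conv_hull_sub => [|_ [x Sx <-]]; last first.
  by exists x => //; exact: sub_conv_hull.
apply/convex_setP => _ _ t [x Sx <-] [y Sy <-] t01.
exists ((1 - t) *: x + t *: y); first exact: conv_hull_segment.
by rewrite linearD !linearZ.
Qed.

(** The image is the hull of the images of the vertices of [A], so each of its vertices is the image
    of an integral point. *)
Lemma image_integral_polytope (R : realType) (n m : nat)
    (pi : {linear 'rV[R]_n -> 'rV[R]_m}) (A : set 'rV[R]_n) :
  integral_map pi -> integral_polytope A -> integral_polytope (pi @` A).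
Proof.
move=> pi_int [/polytope_vertices[finA AE] A_int].
have piAE : pi @` A = conv_hull (pi @` vertex A).
  by rewrite -image_conv_hull -AE.
split; first by exists (pi @` vertex A) => //; exact: finite_image.
by rewrite piAE => v /vertex_conv_hull[w /A_int Aw <-]; exact: pi_int.
Qed.

Lemma image_minkowski_sum (R : realType) (n m : nat)
    (pi : {linear 'rV[R]_n -> 'rV[R]_m}) (A B : set 'rV[R]_n) :
  pi @` minkowski_sum A B = minkowski_sum (pi @` A) (pi @` B).
Proof.
apply/seteqP; split.
  move=> _ [_ [a Aa [b Bb <-]] <-].
  by exists (pi a); [exists a|exists (pi b); [exists b|rewrite linearD]].
move=> _ [_ [a Aa <-] [_ [b Bb <-] <-]].
by exists (a + b); [exists a => //; exists b|rewrite linearD].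
Qed.

Lemma minkowski_sumC (R : realType) (n : nat) (A B : set 'rV[R]_n) :
  minkowski_sum A B = minkowski_sum B A.
Proof.
by apply/seteqP; split=> _ [a Aa [b Bb <-]];
  exists b => //; exists a => //; rewrite addrC.
Qed.

Lemma minkowski_sum_image_two_points (R : realType) (n m : nat)
    (pi : {linear 'rV[R]_n -> 'rV[R]_m}) (A B : set 'rV[R]_n) v s :
  (pi @` minkowski_sum A B) v ->
  (forall x, minkowski_sum A B x -> pi x = v -> x = s) ->
  has_two_points B -> has_two_points (pi @` B).
Proof.
move=> [_ [a Aa [b Bb <-]] vE] fib [b1 [b2 [Bb1 Bb2 b12]]].
apply: contrapT => npi.
have pib b' : B b' -> pi b' = pi b.
  move=> Bb'; apply: contrapT => ne; apply: npi.
  by exists (pi b'), (pi b); split=> //; exact: imageP.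
(* If [pi] is constant on [B], all of [a + B] lies over [v] and collapses to [s]; cancelling [a]
   identifies [b1] with [b2]. *)
have abs b' : B b' -> a + b' = s.
  move=> Bb'; apply: fib; first by exists a => //; exists b'.
  by rewrite linearD /= (pib b') // -linearD.
by apply: b12; apply: (addrI a); rewrite !abs.
Qed.

Theorem theorem9 (R : realType) (m n : nat) (Q : set 'rV[R]_m)
    (pi : {linear 'rV[R]_n -> 'rV[R]_m}) (S : set 'rV[R]_n)
    (Q_indec : integrally_indecomposable Q)
    (pi_int : integral_map pi)
    (S_fin : finite_set S)
    (S_int : forall s, S s -> integral_point s)
    (S_sub : S `<=` pi @^-1` Q)
    (S_vertex : forall v, vertex Q v -> exists! s, S s /\ pi s = v) :
  integrally_indecomposable (conv_hull S).
Proof.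
split; first by split; [exists S|move=> v /vertex_conv_hull/S_int].
move=> [A [B [Aint Bint A2 B2 SE]]].
have [[/polytope_vertices[_ QE] _] Q_nd] := Q_indec.
have cQ : @convex_set R 'rV[R]_m Q by rewrite QE; exact: convex_conv_hull.
have piS : pi @` conv_hull S = Q.
  rewrite image_conv_hull; apply/seteqP; split.
    by apply: conv_hull_sub => // _ [s Ss <-]; exact: S_sub.
  rewrite [X in X `<=` _]QE.
  apply: conv_hull_sub => [|v /S_vertex[s [[Ss <-] _]]].
    exact: convex_conv_hull.
  by apply: sub_conv_hull; exists s.
(* [Q] is the hull of its vertices and is nonempty because [A] and [B] are. *)
have [v vQ] : vertex Q !=set0.
  apply: conv_hull_nonempty; rewrite -QE -piS SE.
  have [a [_ [Aa _ _]]] := A2; have [b [_ [Bb _ _]]] := B2.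
  by exists (pi (a + b)), (a + b) => //; exists a => //; exists b.
have [s [_ s_uniq]] := S_vertex v vQ.
have fib x : conv_hull S x -> pi x = v -> x = s.
  apply: (conv_hull_fiber _ _ _ _ _ _ cQ vQ S_sub) => y Sy yv.
  by apply/esym/s_uniq.
have vS : (pi @` conv_hull S) v by rewrite piS; case: vQ.
rewrite SE in piS fib vS.
apply: Q_nd; exists (pi @` A), (pi @` B); split.
- exact: image_integral_polytope.
- exact: image_integral_polytope.
(* The lemma concerns the second summand, so the summands are swapped to treat [A]. *)
- rewrite minkowski_sumC in vS fib.
  apply: minkowski_sum_image_two_points; last exact: A2.
    exact: vS.
  exact: fib.
- apply: minkowski_sum_image_two_points; last exact: B2.
    exact: vS.
  exact: fib.
- by rewrite -image_minkowski_sum.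
Qed.
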